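(* Let $G$ be an essential reflection group of rank $n$ acting on $V$, let $\pi_1,\dots,\pi_n$ be a set of basic invariants of $G$, and let $X = \mathrm{V}_{\mathbb{R}}(f_1,\dots,f_m) \subseteq V$ be nonempty. If there is $j \in \{1,\dots,n\}$ such that $f_1,\dots,f_m \in \mathbb{R}[\pi_i : i \neq j]$, then $X \cap \mathcal{H}_{n-1}(G) \neq \emptyset$.
   Context: A (real) reflection group $G$ acting on a Euclidean space $V$ is a finite group of orthogonal transformations generated by reflections. $G$ is essential if it fixes no nontrivial linear subspace pointwise; then its rank is $n = \dim V$. Its reflection arrangement is the set of reflection hyperplanes of all reflections in $G$, flats are intersections of reflection hyperplanes (including $V$ itself), and $\mathcal{H}_i(G)$ is the set of points of $V$ contained in a flat of dimension $i$. Thus $\mathcal{H}_{n-1}(G)$ is the union of all reflection hyperplanes. A set of basic invariants $\pi_1,\dots,\pi_n$ is a set of $n$ algebraically independent homogeneous generators of the invariant ring $\mathbb{R}[V]^G$, labelled by nondecreasing degree. $\mathrm{V}_{\mathbb{R}}(f_1,\dots,f_m) = \{p \in V : f_1(p) = \dots = f_m(p) = 0\}$ denotes the set of common real zeros. *)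

(* Defs.v *)
(* mpoly is not re-exported: its notations clash with those of
   MathComp-Analysis. *)
From mathcomp Require Import all_boot all_order all_algebra all_fingroup.
From mathcomp Require Import all_character.
From mathcomp Require Import classical_sets reals.
From mathcomp Require Import mpoly.

Set Implicit Arguments.
Unset Strict Implicit.
Unset Printing Implicit Defensive.

Import GRing.Theory.
Local Open Scope classical_set_scope.
Local Open Scope ring_scope.

(* V is the space of row vectors 'rV[R]_n with its standard inner product
   (v, w) |-> v *m w^T; matrices act on V by right multiplication, and linear
   subspaces of V are row spaces of n x n matrices. *)

Section ReflectionGroups.
Variables (R : realType) (n : nat).

Definition is_orthogonal (g : 'M[R]_n) : Prop := g *m g^T = 1%:M.

Definition is_reflection (s : 'M[R]_n) : Prop :=
  exists a : 'rV[R]_n,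
    [/\ a != 0, a *m s = - a & forall v : 'rV[R]_n, v *m a^T = 0 -> v *m s = v].

(* For a reflection s, its fixed space is the hyperplane of s. *)
Definition reflection_hyperplane (s : 'M[R]_n) : 'M[R]_n := eigenspace s 1.

Variables (gT : finGroupType) (G : {group gT}) (rG : mx_representation R G n).

Definition reflections_in (S : {set gT}) : Prop :=
  forall s, s \in S -> s \in G /\ is_reflection (rG s).

(* A finite group of orthogonal transformations is a faithful representation of
   a finite group by orthogonal matrices; here it is moreover generated by
   reflections. *)
Definition reflection_group : Prop :=
  [/\ mx_faithful rG,
      forall g, g \in G -> is_orthogonal (rG g)
    & exists S : {set gT}, reflections_in S /\ <<S>>%g = G].

Definition essential : Prop :=
  forall U : 'M[R]_n, (forall g, g \in G -> U *m rG g = U) -> U = 0.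

(* S may be empty, in which case the intersection is V. *)
Definition is_flat (L : 'M[R]_n) : Prop :=
  exists S : {set gT}, reflections_in S /\
    (L == \bigcap_(s in S) reflection_hyperplane (rG s))%MS.

Definition flat_points (i : nat) : set 'rV[R]_n :=
  [set p | exists L : 'M[R]_n, [/\ is_flat L, \rank L = i & (p <= L)%MS]].

(* f.@[v ord0] is the value of f at the coordinates of the row vector v. *)
Definition invariant_poly (f : {mpoly R[n]}) : Prop :=
  forall g, g \in G ->
    forall v : 'rV[R]_n, f.@[(v *m rG g) ord0] = f.@[v ord0].

(* f belongs to the subalgebra R[t_1, ..., t_k]. *)
Definition in_subalgebra k (t : k.-tuple {mpoly R[n]}) (f : {mpoly R[n]}) :
    Prop :=
  exists P : {mpoly R[k]}, f = P \mPo t.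

Definition alg_independent k (t : k.-tuple {mpoly R[n]}) : Prop :=
  forall P : {mpoly R[k]}, P \mPo t = 0 -> P = 0.

(* msize is the degree plus one on nonzero polynomials; the members of an
   algebraically independent family are nonzero. *)
Definition basic_invariants (pi : n.-tuple {mpoly R[n]}) : Prop :=
  [/\ alg_independent pi,
      forall i, exists d, tnth pi i \is d.-homog,
      forall f, invariant_poly f <-> in_subalgebra pi f
    & forall i k : 'I_n, (i <= k)%N ->
        (msize (tnth pi i) <= msize (tnth pi k))%N].

(* f belongs to R[pi_i : i != j]: lift j enumerates the indices other than j. *)
Definition in_subalgebra_omit (pi : n.-tuple {mpoly R[n]}) (j : 'I_n)
    (f : {mpoly R[n]}) : Prop :=
  in_subalgebra [tuple tnth pi (lift j i) | i < n.-1] f.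

Definition real_zeros m (f : 'I_m -> {mpoly R[n]}) : set 'rV[R]_n :=
  [set p | forall k, (f k).@[p ord0] = 0].

End ReflectionGroups.

(* Main.v *)
(* The squared norm N is a linear combination sum_i c_i pi_i, since the pi_i
   have degree at least 2. Put b = c_j, or b = 1 if c_j = 0. Given p in X and a
   large K, minimise b pi_j + K sum_(i <> j) (pi_i - pi_i(p))^2 on the ball N
   <= N(p) + 1: the minimum is attained at an interior point, where the
   differentials of the pi_i are therefore linearly dependent. At a point with
   trivial stabilizer they are independent, because averaging over G produces
   invariants with arbitrary differential there. So the minimiser has a
   nontrivial stabilizer, hence lies on a reflection hyperplane (a point on no
   such hyperplane lies in an open chamber, and G acts freely on the chambers).
   As K grows, the values of the pi_i (i <> j) at the minimisers tend to
   pi_i(p), and by compactness of the union of the hyperplanes within the ball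
   they are attained there. *)
Require Import Defs.
From mathcomp Require Import all_boot all_order all_algebra all_fingroup.
From mathcomp Require Import all_character.
From mathcomp Require Import classical_sets reals.
From mathcomp Require mpoly.
From mathcomp Require Import boolp ring lra.
From mathcomp Require polyrcf topology normedtype derive.

Set Implicit Arguments.
Unset Strict Implicit.
Unset Printing Implicit Defensive.

Import Order.TTheory GRing.Theory Num.Theory.
Local Open Scope ring_scope.

(** * Inner product and unit normals of reflections *)

Section Dot.
Variables (R : realType) (n : nat).
Implicit Types (u v w a : 'rV[R]_n) (g : 'M[R]_n).

Definition dot u v : R := (u *m v^T) 0 0.

Lemma dotE u v : dot u v = \sum_i u 0 i * v 0 i.
Proof. by rewrite /dot mxE; apply: eq_bigr => i _; rewrite mxE. Qed.

Lemma dotC u v : dot u v = dot v u.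
Proof. by rewrite !dotE; apply: eq_bigr => i _; rewrite mulrC. Qed.

Lemma dotDl u v w : dot (u + v) w = dot u w + dot v w.
Proof. by rewrite /dot mulmxDl mxE. Qed.

Lemma dotZl c u v : dot (c *: u) v = c * dot u v.
Proof. by rewrite /dot -scalemxAl mxE. Qed.

Lemma dotNl u v : dot (- u) v = - dot u v.
Proof. by rewrite -scaleN1r dotZl mulN1r. Qed.

Lemma dotBl u v w : dot (u - v) w = dot u w - dot v w.
Proof. by rewrite dotDl dotNl. Qed.

Lemma dotZr c u v : dot u (c *: v) = c * dot u v.
Proof. by rewrite dotC dotZl dotC. Qed.

Lemma dotNr u v : dot u (- v) = - dot u v.
Proof. by rewrite dotC dotNl dotC. Qed.

Lemma dotDr u v w : dot u (v + w) = dot u v + dot u w.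
Proof. by rewrite dotC dotDl !(dotC u). Qed.

Lemma dotBr u v w : dot u (v - w) = dot u v - dot u w.
Proof. by rewrite dotDr dotNr. Qed.

Lemma dot_ge0 u : 0 <= dot u u.
Proof. by rewrite dotE; apply: sumr_ge0 => i _; rewrite -expr2 sqr_ge0. Qed.

Lemma dot_eq0 u : (dot u u == 0) = (u == 0).
Proof.
apply/idP/eqP => [|->]; last by rewrite dotE big1 // => i _; rewrite mxE mul0r.
rewrite dotE psumr_eq0 => [/allP h|i _]; last by rewrite -expr2 sqr_ge0.
apply/rowP => i; rewrite mxE; apply/eqP; rewrite -sqrf_eq0 expr2.
exact: h (mem_index_enum i).
Qed.

Lemma dot_gt0 u : (0 < dot u u) = (u != 0).
Proof. by rewrite lt_neqAle dot_ge0 andbT eq_sym dot_eq0. Qed.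

Lemma dot_mulmx_orthogonal u v g :
  Defs.is_orthogonal g -> dot (u *m g) (v *m g) = dot u v.
Proof.
by move=> og; rewrite /dot trmx_mul mulmxA -(mulmxA u) og mulmx1.
Qed.

(** Removing from [v] its projection on the normal leaves a vector that [s] fixes; rescaling the
    normal to length 1 clears the denominator. *)
Lemma reflection_unit_normal (s : 'M[R]_n) : is_reflection s ->
  exists2 a, dot a a = 1 & forall v, v *m s = v - (2 * dot v a) *: a.
Proof.
case=> a [a0 aN aF].
have d0 : 0 < dot a a by rewrite dot_gt0.
pose r := Num.sqrt (dot a a).
have r0 : 0 < r by rewrite sqrtr_gt0.
have rr : r * r = dot a a by rewrite -expr2 sqr_sqrtr // ltW.
exists (r^-1 *: a) => [|v].
  by rewrite dotZl dotZr -rr mulKf ?mulVf ?gt_eqF.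
pose c := dot v a / dot a a.
have h : (v - c *: a) *m a^T = 0.
  apply/matrixP => i j; rewrite !ord1 [RHS]mxE.
  by rewrite -/(dot _ _) dotBl dotZl /c divfK ?subrr // gt_eqF.
have {1}-> : v = (v - c *: a) + c *: a by rewrite subrK.
rewrite mulmxDl aF // -scalemxAl aN scalerN -addrA -scalerN.
rewrite dotZr scalerA scalerN.
congr (_ + _); rewrite -opprD -scalerDl; congr (- (_ *: _)).
rewrite /c -rr.
by field; rewrite gt_eqF.
Qed.

End Dot.

(** * Points on no mirror have trivial stabilizer *)

Section Stabilizer.
Variables (R : realType) (n : nat) (gT : finGroupType) (G : {group gT}).
Variable (rG : mx_representation R G n).
Hypothesis (hG : reflection_group rG).
Variable (x : 'rV[R]_n).
Hypothesis x_regular :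
  forall s, s \in G -> is_reflection (rG s) -> x *m rG s != x.

Implicit Types (s t g : gT) (a b v : 'rV[R]_n).

Let orthG g : g \in G -> Defs.is_orthogonal (rG g).
Proof. by case: hG => _ h _; apply: h. Qed.

(** The unit normal of the mirror of [s] on the side of [x]: the regular point [x] singles out the
    positive roots, and [dot x a] is the height of [a]. *)
Definition pos_root s a : Prop :=
  [/\ s \in G, dot a a = 1, 0 < dot x a
    & forall v, v *m rG s = v - (2 * dot v a) *: a].

Lemma is_reflection_dot s a : a != 0 -> dot a a = 1 ->
  (forall v, v *m rG s = v - (2 * dot v a) *: a) -> is_reflection (rG s).
Proof.
move=> a0 a1 h; exists a; split=> // [|v va].
  by rewrite h a1 mulr1 scalerDl !scale1r opprD addrA subrr sub0r.
by rewrite h /dot va mxE mulr0 scale0r subr0.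
Qed.

Lemma unit_neq0 a : dot a a = 1 -> a != 0.
Proof. by move=> a1; rewrite -dot_gt0 a1 ltr01. Qed.

Lemma pos_root_or_opp s a : s \in G -> dot a a = 1 ->
  (forall v, v *m rG s = v - (2 * dot v a) *: a) ->
  pos_root s a \/ pos_root s (- a).
Proof.
move=> sG a1 h.
have : dot x a != 0.
  apply: contra (x_regular sG (is_reflection_dot (unit_neq0 a1) a1 h)).
  by move=> /eqP xa; rewrite h xa mulr0 scale0r subr0.
case: ltgtP => // xa _; [right|by left].
split=> //; rewrite ?dotNl ?dotNr ?opprK ?oppr_gt0 // => v.
by rewrite h dotNr mulrN scaleNr scalerN opprK.
Qed.

Lemma pos_root_exists s : s \in G -> is_reflection (rG s) ->
  exists a, pos_root s a.
Proof.
move=> sG /reflection_unit_normal[a a1 h].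
by case: (pos_root_or_opp sG a1 h) => ?; [exists a|exists (- a)].
Qed.

Lemma pos_root_mulmx s a : pos_root s a -> a *m rG s = - a.
Proof.
by case=> _ a1 _ ->; rewrite a1 mulr1 scalerDl !scale1r opprD addrA subrr sub0r.
Qed.

Lemma pos_root_uniq s t a : pos_root s a -> pos_root t a -> s = t.
Proof.
case=> sG _ _ hs [tG _ _ ht].
case: hG => /mx_faithful_inj inj _ _; apply: inj => //.
by apply/row_matrixP => i; rewrite !rowE hs ht.
Qed.

Lemma pos_root_sq s a : pos_root s a -> (s * s = 1)%g.
Proof.
case=> sG a1 _ h; case: hG => /mx_faithful_inj inj _ _.
apply: inj; rewrite ?groupM ?group1 // repr_mxM // repr_mx1.
apply/row_matrixP => i; rewrite !rowE mulmx1 mulmxA !h.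
rewrite dotBl dotZl a1 -addrA -opprD -scalerDl.
set c := (X in X *: _); have -> : c = 0 by rewrite /c; ring.
by rewrite scale0r subr0.
Qed.

Lemma pos_root_conj s a g : pos_root s a -> g \in G ->
  pos_root (s ^ g)%g (a *m rG g) \/ pos_root (s ^ g)%g (- (a *m rG g)).
Proof.
case=> sG a1 _ h gG; apply: pos_root_or_opp; first exact: groupJ.
  by rewrite dot_mulmx_orthogonal ?a1 //; exact: orthG.
move=> v; rewrite /conjg !repr_mxM ?groupM ?groupV //.
rewrite !mulmxA h mulmxBl repr_mxKV // -scalemxAl; congr (_ - (_ * _) *: _).
by rewrite -(dot_mulmx_orthogonal _ _ (orthG gG)) repr_mxKV.
Qed.

Lemma pos_root_conj_gt0 s a g : pos_root s a -> g \in G ->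
  0 < dot x (a *m rG g) -> pos_root (s ^ g)%g (a *m rG g).
Proof.
move=> sa gG x0; case: (pos_root_conj sa gG) => // -[_ _ + _].
by rewrite dotNr oppr_gt0 ltNge ltW.
Qed.

Lemma pos_root_conj_le0 s a g : pos_root s a -> g \in G ->
  ~ 0 < dot x (a *m rG g) -> pos_root (s ^ g)%g (- (a *m rG g)).
Proof. by move=> sa gG x0; case: (pos_root_conj sa gG) => // -[_ _ /x0]. Qed.

(** Simplicity is encoded as the property that the exchange argument uses: [s] keeps every positive
    root other than [a] positive. *)
Definition simple_root s a : Prop := pos_root s a /\
  forall t b, pos_root t b -> b <> a -> 0 < dot x (b *m rG s).

Definition simple_reflections (l : seq gT) : Prop :=
  forall s, s \in l -> exists a, simple_root s a.

Definition simple_generated g : Prop :=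
  exists2 l, simple_reflections l & g = (\prod_(s <- l) s)%g.

Lemma simple_generatedM g h :
  simple_generated g -> simple_generated h -> simple_generated (g * h)%g.
Proof.
move=> [l hl ->] [k hk ->]; exists (l ++ k); last by rewrite big_cat.
by move=> s; rewrite mem_cat => /orP[/hl|/hk].
Qed.

(* Descent on the height [dot x a]: if s is not simple, some positive root
   b != a has b s negative, and 2 (b . a) a = b - b s with 0 < b . a < 1. So one
   of b, - b s is lower than a, and conjugating s by its reflection lowers a. *)
Lemma pos_root_simple_generated s a : pos_root s a -> simple_generated s.
Proof.
(* Heights are real, so the induction runs on the number of reflections whose positive root is lower
   than [a]. *)
pose lower a := #|[set t | `[< exists2 b, pos_root t b & dot x b < dot x a >]]|.
have [k] := ubnP (lower a).
elim: k s a => // k IH s a ltk sa.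
have {}IH t b : pos_root t b -> dot x b < dot x a -> simple_generated t.
  move=> tb ba; apply: (IH t b) => //.
  rewrite -ltnS; apply: leq_trans ltk; rewrite ltnS; apply: proper_card.
  apply/properP; split.
    apply/fintype.subsetP => u; rewrite !inE => -[c uc cb].
    by exists c => //; apply: lt_trans ba.
  (* [t] counts for [a] but not for [b]: two positive roots of [t] are proportional unit vectors of
     positive height, hence equal. *)
  exists t; rewrite !inE; first by exists b.
  apply/asboolP => -[c tc cb].
  suff ebc : b = c by rewrite ebc ltxx in cb.
  case: (tb) => tG b1 xb _; case: (tc) => _ c1 xc /(_ b).
  rewrite (pos_root_mulmx tb) => /eqP.
  rewrite eq_sym subr_eq addrC -subr_eq opprK => /eqP e.
  have {}e : b = dot b c *: c.
    apply: (@scalerI _ _ (2 : R)); first by rewrite pnatr_eq0.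
    by rewrite scalerA -e scalerDl scale1r.
  have [p {}e] : exists p, b = p *: c by exists (dot b c).
  move: xb b1; rewrite e !dotZr dotZl c1 mulr1 pmulr_lgt0 // => p0 q1.
  by have -> : p = 1 by [nra]; rewrite scale1r.
case: (pselect (simple_root s a)) => [ss|ns].
  exists [:: s]; last by rewrite big_seq1.
  by move=> t; rewrite inE => /eqP ->; exists a.
case: (sa) => sG a1 xa hs.
(* The height of [a *m rG u] lies strictly between [- dot x a] and [dot x a], so the positive root
   of the conjugate is lower than [a] whatever its sign. *)
have lower_case u c : pos_root u c -> 0 < dot c a -> dot c a <= 1 ->
    dot x c < dot x a -> simple_generated s.
  move=> uc c0 c1 ca; have su := IH _ _ uc ca.
  case: (uc) => uG cc xc hu.
  have -> : s = (u * (s ^ u) * u)%g.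
    by rewrite conjgE !mulgA -!mulgA (pos_root_sq uc) mulg1 mulKVg.
  apply: simple_generatedM => //; apply: simple_generatedM => //.
  have xau : dot x (a *m rG u) = dot x a - 2 * dot c a * dot x c.
    by rewrite hu dotBr dotZr (dotC a).
  case: (pos_root_conj sa uG) => h; apply: (IH _ _ h); rewrite ?dotNr xau; nra.
have [t [b [tb bna bs]]] :
    exists t b, [/\ pos_root t b, b <> a & ~ 0 < dot x (b *m rG s)].
  apply: contrapT => H; apply: ns; split=> // t b tb ba.
  by apply: contrapT => nb; apply: H; exists t, b.
have tsb := pos_root_conj_le0 tb sG bs.
case: (tb) => tG b1 xb ht; case: (tsb) => _ _ xbs _.
have c1 : dot b a < 1.
  have : 0 < dot (b - a) (b - a) by rewrite dot_gt0 subr_eq0; apply/eqP.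
  rewrite dotBl !dotBr b1 a1 (dotC a b); lra.
have dc : dot (- (b *m rG s)) a = dot b a.
  by rewrite dotNl hs dotBl dotZl a1; ring.
have hh : dot x b + dot x (- (b *m rG s)) = 2 * dot b a * dot x a.
  by rewrite dotNr hs dotBr dotZr; ring.
have c0 : 0 < dot b a by rewrite -(@pmulr_lgt0 _ (dot x a)) //; nra.
have [h|h] := ltP (dot x b) (dot x a).
  by apply: (lower_case _ _ tb) => //; exact: ltW.
by apply: (lower_case _ _ tsb); rewrite ?dc //; [exact: ltW|nra].
Qed.

Lemma simple_reflections_mem l : simple_reflections l ->
  (\prod_(s <- l) s)%g \in G.
Proof.
move=> hl; rewrite big_seq; apply: group_prod => s /hl[a [[]]] //.
Qed.

(** The exchange condition: follow [a] along the word. Just before the first letter [t] that makes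
    it negative it must be the simple root of [t], so [s] conjugated by the prefix is [t]. *)
Lemma simple_exchange s a l : pos_root s a -> simple_reflections l ->
  dot x (a *m rG (\prod_(t <- l) t)%g) < 0 ->
  exists l1 t l2, [/\ l = l1 ++ t :: l2, exists b, pos_root t b
    & (s * \prod_(u <- l1) u = \prod_(u <- l1) u * t)%g].
Proof.
elim: l s a => [|t l IH] s a sa hl.
  rewrite big_nil repr_mx1 mulmx1; case: sa => _ _ xa _.
  by rewrite ltNge ltW.
have [b tb] : exists b, simple_root t b by apply: hl; rewrite mem_head.
have {}hl : simple_reflections l.
  by move=> u ul; apply: hl; rewrite inE ul orbT.
case: (tb) => -[tG _ _ _] _.
have [eab|nab] := pselect (a = b).
  move=> _; exists [::], t, l; split=> //; first by exists b; case: tb.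
  rewrite big_nil mulg1 mul1g; apply: (pos_root_uniq sa).
  by rewrite eab; case: tb.
have at0 : 0 < dot x (a *m rG t) by case: tb => _; apply; [exact: sa|].
rewrite big_cons repr_mxM ?simple_reflections_mem // mulmxA.
case/(IH _ _ (pos_root_conj_gt0 sa tG at0) hl) => l1 [u [l2 [-> hu e]]].
exists (t :: l1), u, l2; split=> //.
by rewrite !big_cons -mulgA -e conjgE !mulgA mulgV mul1g.
Qed.

(** The tail of the word makes the root of its first letter negative, so the exchange condition
    deletes two letters without changing the product; induct on the length. *)
Lemma simple_word_trivial l : simple_reflections l ->
  (forall t b, pos_root t b -> 0 < dot x (b *m rG (\prod_(s <- l) s)%g)) ->
  (\prod_(s <- l) s = 1)%g.
Proof.
have [k] := ubnP (size l).
elim: k l => // k IH [|s l]; first by rewrite big_nil.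
rewrite /= ltnS => szl hsl pos.
have [a [sa _]] : exists a, simple_root s a by apply: hsl; rewrite mem_head.
have hl : simple_reflections l.
  by move=> u ul; apply: hsl; rewrite inE ul orbT.
have : dot x (a *m rG (\prod_(t <- l) t)%g) < 0.
  have := pos _ _ sa; rewrite big_cons repr_mxM ?simple_reflections_mem //.
    by rewrite mulmxA (pos_root_mulmx sa) mulNmx dotNr oppr_gt0.
  by case: sa.
case/(simple_exchange sa hl) => l1 [t [l2 [el [b tb] e]]].
have e2 : (\prod_(s0 <- s :: l) s0 = \prod_(s0 <- l1 ++ l2) s0)%g.
  rewrite el big_cons !big_cat big_cons /= !mulgA e.
  by rewrite -(mulgA _ t t) (pos_root_sq tb) mulg1.
rewrite e2; apply: IH => [|u ul|u c uc]; last by rewrite -e2; exact: pos uc.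
  by apply: leq_ltn_trans szl; rewrite el !size_cat /= addnS.
by apply: hl; move: ul; rewrite el !mem_cat inE => /orP[]->; rewrite ?orbT.
Qed.

(** If [g] fixes [x] it preserves heights, hence positivity of roots; as a word in simple
    reflections it is then trivial. *)
Lemma regular_stabilizer g : g \in G -> x *m rG g = x -> g = 1%g.
Proof.
move=> gG xg.
suff [l hl eg] : simple_generated g.
  rewrite eg; apply: simple_word_trivial => // t b tb.
  by rewrite -eg -{1}xg dot_mulmx_orthogonal; [case: tb|exact: orthG].
case: hG gG => _ _ [S [hS <-]] /gen_prodgP[k [c cS ->]].
apply: (big_ind simple_generated) => [||i _].
- by exists [::]; rewrite ?big_nil.
- exact: simple_generatedM.
- have [sG /pos_root_exists[//|a]] := hS _ (cS i).
  exact: pos_root_simple_generated.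
Qed.

End Stabilizer.

(** * Polynomials restricted to lines, and their low-order coefficients *)

Lemma poly_horner_inj (R : numDomainType) (p q : {poly R}) :
  (forall t, p.[t] = q.[t]) -> p = q.
Proof.
move=> pq; apply/eqP; rewrite -subr_eq0; apply/negPn/negP => d0.
pose s := [seq i%:R : R | i <- iota 0 (size (p - q)%R)].
suff : (size s < size (p - q)%R)%N by rewrite size_map size_iota ltnn.
apply: max_poly_roots => //.
  by apply/allP => t _; rewrite /root hornerD hornerN pq subrr.
by rewrite map_inj_uniq ?iota_uniq // => i j /eqP; rewrite eqr_nat => /eqP.
Qed.

Section Polynomials.
Import mpoly.
Variable R : realType.

Lemma mpoly_ring_ind n (P : {mpoly R[n]} -> Prop) :
  (forall c, P c%:MP) -> (forall i, P 'X_i) ->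
  (forall p q, P p -> P q -> P (p + q)) ->
  (forall p q, P p -> P q -> P (p * q)) -> forall p, P p.
Proof.
move=> PC PX PD PM; elim/mpolyind => [|c m p _ _ Pp]; first by rewrite -mpolyC0.
apply: PD => //; rewrite -mul_mpolyC; apply: (PM) => //.
have P1 : P 1 by rewrite -mpolyC1.
rewrite mpolyXE_id; apply: (big_ind P P1 PM) => i _.
by elim: (m i) => [|k IH]; rewrite ?expr0 // exprS; apply: PM.
Qed.

Section Line.
Variable n : nat.
Implicit Types (x v y : 'rV[R]_n) (f g : {mpoly R[n]}).

(** The polynomial t -> f(x + t v). Its coefficient of degree 1 is the derivative of [f] at [x]
    along [v], and serves as the differential throughout. *)
Definition line x v f : {poly R} :=
  locked (mmap (@polyC R) (fun i => (x 0 i)%:P + v 0 i *: 'X) f).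

Lemma lineC x v c : line x v c%:MP = c%:P.
Proof. by rewrite /line -lock mmapC. Qed.

Lemma lineX x v i : line x v 'X_i = (x 0 i)%:P + v 0 i *: 'X.
Proof. by rewrite /line -lock mmapX mmap1U. Qed.

Lemma lineD x v f g : line x v (f + g) = line x v f + line x v g.
Proof. by rewrite /line -!lock mmapD. Qed.

Lemma lineM x v f g : line x v (f * g) = line x v f * line x v g.
Proof. by rewrite /line -!lock rmorphM. Qed.

Lemma line_horner x v f t : (line x v f).[t] = f.@[(x + t *: v) ord0].
Proof.
elim/mpoly_ring_ind: f => [c|i|p q IHp IHq|p q IHp IHq].
- by rewrite lineC hornerC mevalC.
- by rewrite lineX mevalXU !hornerE !mxE mulrC.
- by rewrite lineD hornerD IHp IHq mevalD.
- by rewrite lineM hornerM IHp IHq mevalM.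
Qed.

Lemma line_coef0 x v f : (line x v f)`_0 = f.@[x ord0].
Proof. by rewrite -horner_coef0 line_horner scale0r addr0. Qed.

Lemma line_dhomog v f d : f \is d.-homog -> line 0 v f = f.@[v ord0] *: 'X^d.
Proof.
move=> /dhomogP hf; apply: poly_horner_inj => t.
rewrite line_horner add0r hornerZ hornerXn !mevalE big_distrl /=.
apply: eq_big_seq => m /hf dm; rewrite -mulrA; congr (_ * _).
have -> : d = (\sum_i m i)%N by rewrite -dm; exact: mdegE.
rewrite expr_sum -big_split /=.
by apply: eq_bigr => i _; rewrite mxE exprMn mulrC.
Qed.

Definition sqdist y : {mpoly R[n]} := \sum_i ('X_i - (y 0 i)%:MP) ^+ 2.

Lemma sqdist_meval y v : (sqdist y).@[v ord0] = dot (v - y) (v - y).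
Proof.
rewrite /sqdist raddf_sum dotE; apply: eq_bigr => i _ /=.
by rewrite rmorphXn /= mevalB mevalXU mevalC !mxE expr2.
Qed.

Lemma line_sqdist y v : line y v (sqdist y) = dot v v *: 'X^2.
Proof.
apply: poly_horner_inj => t.
rewrite line_horner sqdist_meval hornerZ hornerXn.
by rewrite addrAC subrr add0r dotZl dotZr; ring.
Qed.

Lemma coef1M (p q : {poly R}) : (p * q)`_1 = p`_0 * q`_1 + p`_1 * q`_0.
Proof. by rewrite coefM !big_ord_recl big_ord0 addr0. Qed.

Lemma coef2M (p q : {poly R}) :
  (p * q)`_2 = p`_0 * q`_2 + p`_1 * q`_1 + p`_2 * q`_0.
Proof. by rewrite coefM !big_ord_recl big_ord0 addr0 addrA. Qed.

Lemma line_compD k (s : k.-tuple {mpoly R[n]}) (p q : {mpoly R[k]}) x v :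
  line x v ((p + q) \mPo s) = line x v (p \mPo s) + line x v (q \mPo s).
Proof. by rewrite comp_mpolyD lineD. Qed.

Lemma line_compM k (s : k.-tuple {mpoly R[n]}) (p q : {mpoly R[k]}) x v :
  line x v ((p * q) \mPo s) = line x v (p \mPo s) * line x v (q \mPo s).
Proof. by rewrite rmorphM lineM. Qed.

(** Chain rule: [M i] is the i-th partial derivative of [P] at the values of [s] at [x], so it does
    not depend on [v]. *)
Lemma line_comp_coef1 k (s : k.-tuple {mpoly R[n]}) (P : {mpoly R[k]}) x :
  exists M : 'I_k -> R, forall v,
    (line x v (P \mPo s))`_1 = \sum_i M i * (line x v (tnth s i))`_1.
Proof.
elim/mpoly_ring_ind: P => [c|i|p q [M hM] [N hN]|p q [M hM] [N hN]].
- exists (fun=> 0) => v; rewrite comp_mpolyC lineC coefC big1 // => i _.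
  by rewrite mul0r.
- exists (fun l => (l == i)%:R) => v.
  rewrite comp_mpolyXU -tnth_nth (bigD1 i) //= eqxx mul1r big1 ?addr0 // => l.
  by move=> /negPf ->; rewrite mul0r.
- have e v := line_compD s p q x v.
  move: (p \mPo s) (q \mPo s) hM hN e => f g hM hN e.
  exists (fun l => M l + N l) => v; rewrite e coefD hM hN.
  by rewrite -big_split; apply: eq_bigr => l _; rewrite mulrDl.
- have e v := line_compM s p q x v.
  move: (p \mPo s) (q \mPo s) hM hN e => f g hM hN e.
  exists (fun l => f.@[x ord0] * N l + M l * g.@[x ord0]).
  move=> v; rewrite e coef1M !line_coef0 hM hN mulr_sumr mulr_suml.
  rewrite -big_split; apply: eq_bigr => l _ /=.
  by rewrite mulrDl !mulrA (mulrAC (M l)).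
Qed.

(** The members of [s] have no terms of degree below 2, so only the linear part of [P] contributes
    in degree 2. *)
Lemma line_comp_coef2 k (s : k.-tuple {mpoly R[n]}) (P : {mpoly R[k]}) :
  (forall i, exists2 d, (1 < d)%N & tnth s i \is d.-homog) ->
  exists c : 'I_k -> R, forall v,
    (line 0 v (P \mPo s))`_2 = \sum_i c i * (tnth s i).@[v ord0].
Proof.
move=> hs.
(* The product rule in degree 2 has a cross term of first-order coefficients; their vanishing is
   carried through the induction to remove it. *)
suff [c hc] : exists c : 'I_k -> R, forall v,
    (line 0 v (P \mPo s))`_1 = 0 /\
    (line 0 v (P \mPo s))`_2 = \sum_i c i * (tnth s i).@[v ord0].
  by exists c => v; case: (hc v).
elim/mpoly_ring_ind: P => [c|i|p q [M hM] [N hN]|p q [M hM] [N hN]].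
- exists (fun=> 0) => v; rewrite comp_mpolyC lineC !coefC big1 // => i _.
  by rewrite mul0r.
- have [d d1 hd] := hs i.
  exists (fun l => ((l == i) && (d == 2))%:R) => v.
  rewrite comp_mpolyXU -tnth_nth (line_dhomog _ hd) !coefZ !coefXn.
  rewrite (bigD1 i) //= eqxx big1 ?addr0 => [|l /negPf ->].
    by rewrite [2 == d]eq_sym ltn_eqF // mulr0 mulrC.
  by rewrite mul0r.
- have e v := line_compD s p q 0 v.
  move: (p \mPo s) (q \mPo s) hM hN e => f g hM hN e.
  exists (fun l => M l + N l) => v; rewrite e !coefD.
  case: (hM v) (hN v) => -> -> [-> ->]; rewrite addr0; split=> //.
  by rewrite -big_split; apply: eq_bigr => l _; rewrite mulrDl.
- have e v := line_compM s p q 0 v.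
  move: (p \mPo s) (q \mPo s) hM hN e => f g hM hN e.
  exists (fun l => f.@[(0 : 'rV_n) ord0] * N l +
                   M l * g.@[(0 : 'rV_n) ord0]).
  move=> v; rewrite e coef1M coef2M !line_coef0.
  case: (hM v) (hN v) => -> -> [-> ->].
  rewrite !(mulr0, mul0r, addr0); split=> //.
  rewrite mulr_sumr mulr_suml -big_split; apply: eq_bigr => l _ /=.
  by rewrite mulrDl !mulrA (mulrAC (M l)).
Qed.

Definition linear_subst (A : 'M[R]_n) : n.-tuple {mpoly R[n]} :=
  [tuple \sum_l A l i *: 'X_l | i < n].

Lemma linear_subst_meval A f v :
  (f \mPo linear_subst A).@[v ord0] = f.@[(v *m A) ord0].
Proof.
rewrite comp_mpoly_meval; apply: meval_eq => i.
rewrite tnth_mktuple raddf_sum mxE; apply: eq_bigr => l _ /=.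
by rewrite mevalZ mevalXU mulrC.
Qed.

Lemma dhomog0E f : f \is 0.-homog -> f = (f@_0%MM)%:MP.
Proof.
move=> hf; apply/mpolyP => m; rewrite mcoeffC.
have [->|m0] := eqVneq 0%MM m; first by rewrite mulr1.
by rewrite mulr0 (dhomog_nemf_coeff hf) // mdeg_eq0 eq_sym.
Qed.

Lemma dhomog1E f : f \is 1.-homog -> f = \sum_i f@_U_(i) *: 'X_i.
Proof.
move=> hf; apply/mpolyP => m; rewrite raddf_sum /=.
have [|m1] := boolP (mdeg m == 1).
  move=> /mdeg1P[i /eqP ->]; rewrite (bigD1 i) //= mcoeffZ mcoeffX eqxx mulr1.
  rewrite big1 ?addr0 // => l li; rewrite mcoeffZ mcoeffX.
  case: eqP => [/mnmP/(_ l)|_]; last by rewrite mulr0.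
  by rewrite !mnm1E eqxx eq_sym (negPf li).
rewrite (dhomog_nemf_coeff hf) // big1 // => i _.
rewrite mcoeffZ mcoeffX; case: eqP => [e|_]; last by rewrite mulr0.
by rewrite -e mdeg1 eqxx in m1.
Qed.

End Line.

(** * Averaging over the group; differentials and degrees of basic invariants *)

Section Invariants.
Variables (n : nat) (gT : finGroupType) (G : {group gT}).
Variable rG : mx_representation R G n.
Implicit Types (x v y : 'rV[R]_n) (f h : {mpoly R[n]}).

Definition orbit_sum h : {mpoly R[n]} :=
  \sum_(g in G) (h \mPo linear_subst (rG g)).

Lemma orbit_sum_meval h v :
  (orbit_sum h).@[v ord0] = \sum_(g in G) h.@[(v *m rG g) ord0].
Proof.
by rewrite raddf_sum; apply: eq_bigr => g _; exact: linear_subst_meval.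
Qed.

Lemma orbit_sum_invariant h : invariant_poly rG (orbit_sum h).
Proof.
move=> g gG v; rewrite !orbit_sum_meval [RHS](reindex_inj (mulgI g)) /=.
apply: eq_big => [k|k kG]; first by rewrite groupMl.
by rewrite repr_mxM // mulmxA.
Qed.

Lemma line_orbit_sum h x v :
  line x v (orbit_sum h) = \sum_(g in G) line (x *m rG g) (v *m rG g) h.
Proof.
apply: poly_horner_inj => t; rewrite line_horner orbit_sum_meval horner_sum.
by apply: eq_bigr => g _; rewrite line_horner mulmxDl scalemxAl.
Qed.

(* Averaging a polynomial that agrees with a linear form to first order at x and
   vanishes to second order at the other points of the orbit of x. *)
Lemma invariant_with_differential x :
  (forall g, g \in G -> x *m rG g = x -> g = 1%g) ->
  exists2 w : R, w != 0 & forall k : 'I_n, exists2 f : {mpoly R[n]},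
    invariant_poly rG f & forall v, (line x v f)`_1 = v 0 k * w.
Proof.
(* Triviality of the stabilizer keeps the zeros of [W] away from [x], so [w] can be its value
   there. *)
move=> hx; pose W := \prod_(g in G :\ 1%g) sqdist (x *m rG g).
exists W.@[x ord0].
  rewrite rmorph_prod; apply/prodf_neq0 => g /setD1P[g1 gG] /=.
  rewrite sqdist_meval dot_eq0 subr_eq0 eq_sym.
  by apply: contraNneq g1 => /(hx _ gG) ->.
move=> k; exists (orbit_sum (('X_k - (x 0 k)%:MP) * W)) => [|v].
  exact: orbit_sum_invariant.
rewrite line_orbit_sum (bigD1 1%g) //= coefD repr_mx1 !mulmx1.
rewrite coef_sum [X in _ + X]big1 ?addr0 => [|g /andP[gG g1]].
  rewrite lineM lineD -mpolyCN lineC lineX polyCN addrAC subrr add0r.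
  by rewrite -scalerAl coefZ coefXM line_coef0.
rewrite lineM /W (big_setD1 g) /= ?inE ?g1 //.
by rewrite lineM line_sqdist mulrCA mulrC -scalerAr coefZ coefMXn mulr0.
Qed.

(** By the chain rule, differentials of invariants are combinations of those of the basic ones, and
    they include every coordinate form times [w]; so the Jacobian matrix [J] is invertible. *)
Lemma basic_invariants_independent_differentials (pi : n.-tuple {mpoly R[n]})
    x (a : 'I_n -> R) :
  basic_invariants rG pi ->
  (forall g, g \in G -> x *m rG g = x -> g = 1%g) ->
  (forall v, \sum_i a i * (line x v (tnth pi i))`_1 = 0) ->
  forall i, a i = 0.
Proof.
move=> [_ _ hinv _] /invariant_with_differential[w w0 hw] ha.
have /boolp.choice[M hM] : forall k, exists M : 'I_n -> R, forall v,
    \sum_i M i * (line x v (tnth pi i))`_1 = v 0 k * w.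
  move=> k; have [f /hinv[P ->] hf] := hw k.
  by have [M hM] := line_comp_coef1 pi P x; exists M => v; rewrite -hM hf.
pose J := \matrix_(i, l) (line x (delta_mx 0 l) (tnth pi i))`_1.
have J1 : (w^-1 *: \matrix_(k, i) M k i) *m J = 1%:M.
  apply/matrixP => k l; rewrite -scalemxAl !mxE.
  under eq_bigr do rewrite !mxE.
  by rewrite hM mxE eqxx /= [k == l]eq_sym mulrC mulfK.
have [_ uJ] := mulmx1_unit J1.
have : (\row_i a i) *m J = 0.
  apply/rowP => l; rewrite !mxE; under eq_bigr do rewrite !mxE.
  exact: ha.
move/(congr1 (mulmx^~ (invmx J))); rewrite mulmxK // mul0mx => /rowP a0 i.
by have := a0 i; rewrite !mxE.
Qed.

(** Degree 0 would make the invariant constant, against algebraic independence. Degree 1 would give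
    a form [dot v a] with [a] fixed by [G], and essentiality makes [a] zero. *)
Lemma basic_invariant_degree (pi : n.-tuple {mpoly R[n]}) i :
  (forall g, g \in G -> Defs.is_orthogonal (rG g)) -> essential rG ->
  basic_invariants rG pi ->
  exists2 d, (1 < d)%N & tnth pi i \is d.-homog.
Proof.
move=> orthG ess [indep hom hinv _].
have [d hd] := hom i; exists d => //.
case: d hd => [/dhomog0E|[/dhomog1E|//]] e.
  have : 'X_i - ((tnth pi i)@_0%MM)%:MP = 0 :> {mpoly R[n]}.
    apply: indep.
    by rewrite comp_mpolyB comp_mpolyXU -tnth_nth comp_mpolyC -e subrr.
  move=> /eqP; rewrite subr_eq0 => /eqP/mpolyP/(_ U_(i)%MM).
  rewrite mcoeffX mcoeffC eqxx mnm1_eq0 mulr0 => /eqP.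
  by rewrite oner_eq0.
pose a := \row_l (tnth pi i)@_U_(l).
have hev v : (tnth pi i).@[v ord0] = dot v a.
  rewrite e raddf_sum dotE; apply: eq_bigr => l _ /=.
  by rewrite mevalZ mevalXU mxE mulrC.
have inva g : g \in G -> a *m rG g = a.
  move=> gG; have hi : invariant_poly rG (tnth pi i).
    by apply/hinv; exists 'X_i; rewrite comp_mpolyXU -tnth_nth.
  have ga : dot (a *m rG g) a = dot a a by rewrite -!hev; exact: hi.
  apply/eqP; rewrite -subr_eq0 -dot_eq0 dotBl !dotBr.
  rewrite dot_mulmx_orthogonal; last exact: orthG.
  by rewrite (dotC a (a *m _)) ga !subrr.
have a0 : a = 0.
  (* Essentiality speaks of square matrices, so [a] is repeated in every row. *)
  have : (\matrix_(k < n) a) = 0.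
    apply: ess => g gG; apply/row_matrixP => k.
    by rewrite row_mul !rowK inva.
  by move=> /row_matrixP/(_ i); rewrite rowK row0.
have : 'X_i = 0 :> {mpoly R[n]}.
  apply: indep; rewrite comp_mpolyXU -tnth_nth e big1 // => l _.
  by have /rowP/(_ l) := a0; rewrite !mxE => ->; rewrite scale0r.
move=> /mpolyP/(_ U_(i)%MM); rewrite mcoeffX mcoeff0 eqxx => /eqP.
by rewrite oner_eq0.
Qed.

(** Orthogonality makes the squared norm invariant, hence a polynomial in the basic invariants;
    comparing coefficients of degree 2 on lines through the origin leaves only its linear part. *)
Lemma sqnorm_basic_invariants (pi : n.-tuple {mpoly R[n]}) :
  (forall g, g \in G -> Defs.is_orthogonal (rG g)) -> essential rG ->
  basic_invariants rG pi ->
  exists c : 'I_n -> R, forall v,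
    dot v v = \sum_i c i * (tnth pi i).@[v ord0].
Proof.
move=> orthG ess bi.
have /(_ _)/= hdeg i := basic_invariant_degree i orthG ess bi.
have [P eP] : in_subalgebra pi (sqdist 0).
  case: bi => _ _ <- _ g gG v.
  by rewrite !sqdist_meval !subr0 dot_mulmx_orthogonal //; exact: orthG.
have [c hc] := line_comp_coef2 P hdeg.
by exists c => v; rewrite -hc -eP line_sqdist coefZ coefXn mulr1.
Qed.

End Invariants.
End Polynomials.

(** * Continuity and attained minima *)

Section Compactness.
Import functions topology normedtype derive numFieldNormedType.Exports.
Local Open Scope classical_set_scope.
Variables (R : realType) (n : nat).

Lemma meval_continuous (f : mpoly.mpoly n R) :
  continuous (fun v : 'rV[R]_n => mpoly.meval (v ord0) f).
Proof.
elim/mpoly_ring_ind: f => [c|i|f g hf hg|f g hf hg].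
- rewrite (_ : (fun v => _) = cst c); first exact: cst_continuous.
  by apply/funext => v; rewrite mpoly.mevalC.
- rewrite (_ : (fun v => _) = (fun v : 'rV[R]_n => v ord0 i)).
    exact: coord_continuous.
  by apply/funext => v; rewrite mpoly.mevalXU.
- move=> v; rewrite (_ : (fun v => _) =
      (fun v : 'rV[R]_n => mpoly.meval (v ord0) f + mpoly.meval (v ord0) g)).
    exact: continuousD (hf v) (hg v).
  by apply/funext => u; rewrite mpoly.mevalD.
- move=> v; rewrite (_ : (fun v => _) =
      (fun v : 'rV[R]_n => mpoly.meval (v ord0) f * mpoly.meval (v ord0) g)).
    exact: continuousM (hf v) (hg v).
  by apply/funext => u; rewrite mpoly.mevalM.
Qed.

(** Extreme value theorem on the zeros of [Q] in a ball; [Q] is later either 0, for the whole ball,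
    or the equation of the mirrors. *)
Lemma meval_min (Q f : mpoly.mpoly n R) (M : R) (p : 'rV[R]_n) :
  dot p p <= M -> mpoly.meval (p ord0) Q = 0 ->
  exists c : 'rV[R]_n, [/\ dot c c <= M, mpoly.meval (c ord0) Q = 0
    & forall v : 'rV[R]_n, dot v v <= M -> mpoly.meval (v ord0) Q = 0 ->
        mpoly.meval (c ord0) f <= mpoly.meval (v ord0) f].
Proof.
move=> pM pQ.
pose A := [set v : 'rV[R]_n | mpoly.meval (v ord0) (sqdist 0) <= M] `&`
  [set v : 'rV[R]_n | mpoly.meval (v ord0) Q = 0].
have AE v : A v <-> dot v v <= M /\ mpoly.meval (v ord0) Q = 0.
  by rewrite /A /= sqdist_meval subr0.
have Acl : closed A.
  apply: closedI.
    have /continuous_closedP h := @meval_continuous (sqdist 0).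
    exact: (h [set x | x <= M] (@closed_le _ M)).
  have /continuous_closedP h := @meval_continuous Q.
  exact: (h [set x | x = 0] (@closed_eq _ 0)).
have Abd : bounded_set A.
  (* Coordinates have square at most [M], hence absolute value at most [M + 1], even when [M] is
     below 1. *)
  exists (M + 1); split; first exact: num_real.
  move=> y My v /AE[vM _].
  have M0 : 0 <= M := le_trans (dot_ge0 v) vM.
  rewrite /Num.norm /= mx_normrE; apply: bigmax_le => [|[i j] _ /=]; first lra.
  rewrite ord1; suff : `|v 0 j| ^+ 2 <= M by nra.
  rewrite real_normK ?num_real // (le_trans _ vM) // dotE (bigD1 j) //= -expr2.
  by rewrite lerDl; apply: sumr_ge0 => k _; rewrite -expr2 sqr_ge0.
have fc : {within A, continuous (fun v : 'rV[R]_n => mpoly.meval (v ord0) f)}.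
  by apply: continuous_subspaceT => v; exact: meval_continuous.
have [|c cA hc] := EVT_min_rV _ (bounded_closed_compact Abd Acl) fc.
  by exists p; apply/AE.
have /AE[cM cQ] : A c by rewrite inE in cA.
exists c; split=> // v vM vQ; apply: hc; rewrite inE; exact/AE.
Qed.

End Compactness.

(** * First-order condition at an interior minimum *)

Section CriticalPoints.
Import mpoly.
Variables (R : realType) (n : nat).
Implicit Types (x v : 'rV[R]_n).

(** For small [t], a nonzero linear coefficient decides the sign of [p.[t] - p.[0]], which is
    negative on one side of 0; [q.[0] < M] keeps small [t] in the allowed region. *)
Lemma poly_local_min_coef1 (p q : {poly R}) (M : R) : q.[0] < M ->
  (forall t, q.[t] <= M -> p.[0] <= p.[t]) -> p`_1 = 0.
Proof.
(* The polynomial becomes [p * 'X + c%:P], so [p.[0]] is from here on the linear coefficient. *)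
elim/poly_ind: p => [|p c _] qM; first by rewrite coef0.
rewrite coefD coefMX coefC addr0 /= -horner_coef0 => hmin.
have [//|p0] := eqVneq p.[0] 0.
have [d d0 hd] : exists2 d, 0 < d & forall y, `|y - 0| < d ->
    `|p.[y] - p.[0]| < `|p.[0]|.
  by apply: polyrcf.poly_cont; rewrite normr_gt0.
have [e e0 he] : exists2 e, 0 < e & forall y, `|y - 0| < e ->
    `|q.[y] - q.[0]| < M - q.[0].
  by apply: polyrcf.poly_cont; rewrite subr_gt0.
have [r [r0 rd re]] : exists r, [/\ 0 < r, r < d & r < e].
  have [de|ed] := ltP d e.
    by exists (d / 2); split; lra.
  by exists (e / 2); split; lra.
have lt0 t : `|t| = r -> p.[0] * t < 0 -> False.
  move=> tr pt; have /hd : `|t - 0| < d by rewrite subr0 tr.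
  have /he : `|t - 0| < e by rewrite subr0 tr.
  rewrite ltr_norml => /andP[_ qt] hp.
  have {qt}/hmin : q.[t] <= M by lra.
  rewrite !hornerE lerDr leNgt => /negP; apply.
  move: hp pt; case: (ltrgtP p.[0] 0) p0 => // p0 _; rewrite ltr_norml.
    by rewrite ltr0_norm // => /andP[h1 h2] h3; nra.
  by rewrite gtr0_norm // => /andP[h1 h2] h3; nra.
exfalso; case: (ltrgtP p.[0] 0) p0 => // p0 _.
  by apply: (lt0 r); [exact: gtr0_norm|nra].
by apply: (lt0 (- r)); [rewrite normrN; exact: gtr0_norm|nra].
Qed.

Lemma line_local_min (f : {mpoly R[n]}) (M : R) x v : dot x x < M ->
  (forall y, dot y y <= M -> f.@[x ord0] <= f.@[y ord0]) ->
  (line x v f)`_1 = 0.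
Proof.
move=> xM hmin; apply: (@poly_local_min_coef1 _ (line x v (sqdist 0)) M).
  by rewrite line_horner scale0r addr0 sqdist_meval subr0.
move=> t; rewrite !line_horner sqdist_meval subr0 scale0r addr0.
exact: hmin.
Qed.

End CriticalPoints.

(** * Mirror points on the fibers of all basic invariants but one *)

Section Main.
Import mpoly.
Variables (R : realType) (n : nat) (gT : finGroupType) (G : {group gT}).
Variable rG : mx_representation R G n.
Hypotheses (hG : reflection_group rG) (hess : essential rG).
Variable pi : n.-tuple {mpoly R[n]}.
Hypothesis hpi : basic_invariants rG pi.
Implicit Types (x v p : 'rV[R]_n).

Definition on_mirror x : Prop :=
  exists s, [/\ s \in G, is_reflection (rG s) & x *m rG s = x].

Lemma independent_differentials_off_mirrors x (a : 'I_n -> R) :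
  ~ on_mirror x ->
  (forall v, \sum_i a i * (line x v (tnth pi i))`_1 = 0) ->
  forall i, a i = 0.
Proof.
move=> nx; apply: (basic_invariants_independent_differentials hpi) => g gG.
apply: (regular_stabilizer hG) => // s sG rs.
by apply: contra_not_neq nx => xs; exists s.
Qed.

(** Each factor is the squared length of [x - x *m rG s], so the union of the mirrors becomes the
    zero set of one polynomial, as [meval_min] requires. *)
Definition mirror_poly : {mpoly R[n]} :=
  \prod_(s in G | `[< is_reflection (rG s) >])
    \sum_i ('X_i - tnth (linear_subst (rG s)) i) ^+ 2.

Lemma mirror_poly_eq0 x : mirror_poly.@[x ord0] = 0 <-> on_mirror x.
Proof.
have ev s : (\sum_i ('X_i - tnth (linear_subst (rG s)) i) ^+ 2).@[x ord0]
    = dot (x - x *m rG s) (x - x *m rG s).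
  rewrite raddf_sum dotE; apply: eq_bigr => i _ /=.
  rewrite rmorphXn /= mevalB mevalXU expr2 !mxE; congr ((_ - _) * (_ - _)).
    rewrite tnth_mktuple raddf_sum; apply: eq_bigr => l _ /=.
    by rewrite mevalZ mevalXU mulrC.
  rewrite tnth_mktuple raddf_sum; apply: eq_bigr => l _ /=.
  by rewrite mevalZ mevalXU mulrC.
rewrite /mirror_poly rmorph_prod; split=> [/eqP/prodf_eq0[s /andP[sG]]|].
  move=> /asboolP rs /=; rewrite ev dot_eq0 subr_eq0 => /eqP xs.
  by exists s.
case=> s [sG rs xs]; apply/eqP/prodf_eq0; exists s.
  by rewrite sG; apply/asboolP.
by rewrite /= ev xs subrr dot_eq0.
Qed.

Definition deviation (j : 'I_n) p : {mpoly R[n]} :=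
  \sum_(i | i != j) (tnth pi i - ((tnth pi i).@[p ord0])%:MP) ^+ 2.

Lemma deviation_meval j p x : (deviation j p).@[x ord0] =
  \sum_(i | i != j) ((tnth pi i).@[x ord0] - (tnth pi i).@[p ord0]) ^+ 2.
Proof.
rewrite raddf_sum; apply: eq_bigr => i _ /=.
by rewrite rmorphXn /= mevalB mevalC.
Qed.

Lemma deviation_ge0 j p x : 0 <= (deviation j p).@[x ord0].
Proof. by rewrite deviation_meval; apply: sumr_ge0 => i _; exact: sqr_ge0. Qed.

Lemma deviation_eq0 j p x : (deviation j p).@[x ord0] = 0 ->
  forall i, i != j -> (tnth pi i).@[x ord0] = (tnth pi i).@[p ord0].
Proof.
move=> /eqP; rewrite deviation_meval psumr_eq0 => [/allP h i ij|i _].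
  by have := h i (mem_index_enum i); rewrite ij sqrf_eq0 subr_eq0 => /eqP.
exact: sqr_ge0.
Qed.

Lemma line_deviation j p x v : (line x v (deviation j p))`_1 =
  \sum_(i | i != j) 2 * ((tnth pi i).@[x ord0] - (tnth pi i).@[p ord0]) *
    (line x v (tnth pi i))`_1.
Proof.
pose D f := (line x v f)`_1.
have D0 : D 0 = 0 by rewrite /D -mpolyC0 lineC coefC.
have DD : {morph D : f g / f + g} by move=> f g; rewrite /D lineD coefD.
rewrite -/(D _) (big_morph D DD D0); apply: eq_bigr => i _.
rewrite /D expr2 lineM coef1M !line_coef0 lineD -mpolyCN lineC coefD coefC.
rewrite addr0.
by rewrite mevalD mevalC; ring.
Qed.

(* Minimise b pi_j + K deviation, with K large, on the ball of radius M around
   the origin. The choice of b makes the minimum interior; there the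
   differentials of the pi_i are dependent, as that of pi_j has coefficient
   b != 0. *)
Lemma mirror_point_small_deviation (j : 'I_n) p (e : R) : 0 < e ->
  exists x, [/\ dot x x <= dot p p + 1, on_mirror x
    & (deviation j p).@[x ord0] <= e].
Proof.
move=> e0; set M := dot p p + 1.
have orthG g : g \in G -> Defs.is_orthogonal (rG g).
  by case: hG => _ h _; exact: h.
have [c hc] := sqnorm_basic_invariants orthG hess hpi.
(* If [c j] is 0, the j-th invariant is absent from the formula for the squared norm and any nonzero
   weight will do. *)
pose b := if c j == 0 then 1 else c j.
have b0 : b != 0 by rewrite /b; case: ifPn => // _; exact: oner_neq0.
have pM : dot p p <= M by rewrite lerDl ler01.
have [z [_ _ hz]] := @meval_min R n 0 (b *: tnth pi j) M p pM (meval0 _).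
pose A := \sum_(i | i != j) c i ^+ 2.
have A0 : 0 <= A by apply: sumr_ge0 => i _; exact: sqr_ge0.
pose B := b * (tnth pi j).@[p ord0] - b * (tnth pi j).@[z ord0].
have hz' v : dot v v <= M ->
    b * (tnth pi j).@[z ord0] <= b * (tnth pi j).@[v ord0].
  by move=> vM; rewrite -!mevalZ; apply: hz => //; exact: meval0.
have B0 : 0 <= B by rewrite subr_ge0 hz'.
(* [B] bounds the drop, on the ball, of [b] times the j-th invariant below its value at [p]. The
   first bound on [K] makes the deviation at most [e]; the second makes it at most 1 / (4 (A + 1)),
   which keeps the minimiser off the boundary. *)
have [K [K0 Ke KA]] : exists K, [/\ 0 < K, B <= e * K & 4 * (A + 1) * B <= K].
  have eB : e * (B / e) = B by rewrite mulrC divfK ?gt_eqF.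
  have Be0 : 0 <= B / e by rewrite divr_ge0 // ltW.
  have AB0 : 0 <= (A + 1) * B by rewrite mulr_ge0 // addr_ge0.
  by exists (B / e + 4 * ((A + 1) * B) + 1); split; nra.
pose f := b *: tnth pi j + K *: deviation j p.
have [x [xM _ hx]] := @meval_min R n 0 f M p pM (meval0 _).
have {}hx v : dot v v <= M -> f.@[x ord0] <= f.@[v ord0].
  by move=> vM; apply: hx => //; exact: meval0.
have fE v : f.@[v ord0] =
    b * (tnth pi j).@[v ord0] + K * (deviation j p).@[v ord0].
  by rewrite mevalD !mevalZ.
have devp : (deviation j p).@[p ord0] = 0.
  by rewrite deviation_meval big1 // => i _; rewrite subrr expr0n.
have fxp : b * (tnth pi j).@[x ord0] + K * (deviation j p).@[x ord0] <=
    b * (tnth pi j).@[p ord0].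
  by have := hx _ pM; rewrite !fE devp mulr0 addr0.
have dx0 := deviation_ge0 j p x.
have KB : K * (deviation j p).@[x ord0] <= B.
  by have := hz' _ xM; rewrite /B; lra.
have dxe : (deviation j p).@[x ord0] <= e.
  by rewrite -(ler_pM2l K0) (le_trans KB) // mulrC.
have dxA : 4 * (A + 1) * (deviation j p).@[x ord0] <= 1.
  rewrite -(ler_pM2l K0) mulr1 mulrCA; apply: le_trans KA.
  by rewrite ler_wpM2l // mulr_ge0 // addr_ge0.
exists x; split=> //.
have xM' : dot x x < M.
  pose u i := (tnth pi i).@[x ord0] - (tnth pi i).@[p ord0].
  suff : dot x x - dot p p < 1 by rewrite /M; lra.
  rewrite !hc -sumrB (eq_bigr (fun i => c i * u i)) => [|i _]; last first.
    by rewrite /u mulrBr.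
  rewrite (bigD1 j) //=.
  (* Minimality against [p], where the deviation is 0, gives [b * u j <= 0]. *)
  have cu : c j * u j <= 0.
    have [->|cj] := eqVneq (c j) 0; first by rewrite mul0r.
    have <- : b = c j by rewrite /b (negPf cj).
    by rewrite /u; nra.
  (* Termwise this is [4 (A + 1) c_i u_i <= c_i^2 + 4 (A + 1)^2 u_i^2]; with the bound on the
     deviation the sum of the [c_i u_i] is below 1/2. *)
  have : 4 * (A + 1) * (\sum_(i | i != j) c i * u i) <=
      A + 4 * (A + 1) ^+ 2 * (deviation j p).@[x ord0].
    rewrite deviation_meval /A !mulr_sumr -big_split /= -/A.
    apply: ler_sum => i _; rewrite -/(u i).
    by have := sqr_ge0 (c i - 2 * (A + 1) * u i); nra.
  by move: (\sum_(i | _) _) => S; nra.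
apply: contrapT => nx; move/eqP: b0; apply.
(* The coefficients of the differential of [f] at [x] in terms of those of the basic invariants: off
   the mirrors all must vanish, yet [a j] is [b]. *)
pose a i := if i == j then b else
  K * (2 * ((tnth pi i).@[x ord0] - (tnth pi i).@[p ord0])).
suff : a j = 0 by rewrite /a eqxx.
apply: (independent_differentials_off_mirrors nx) => v.
have := line_local_min v xM' hx.
rewrite /f lineD coefD -!mul_mpolyC !lineM !lineC !coefCM line_deviation => h.
rewrite (bigD1 j) //= {1}/a eqxx -[RHS]h mulr_sumr; congr (_ + _).
by apply: eq_bigr => i /negPf ij; rewrite /a ij [RHS]mulrA.
Qed.

(** On the compact set of mirror points in the ball the deviation attains its minimum, which is at
    most every positive [e], hence 0. *)
Lemma mirror_point_on_fiber (j : 'I_n) p : exists2 x, on_mirror x &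
  forall i, i != j -> (tnth pi i).@[x ord0] = (tnth pi i).@[p ord0].
Proof.
have [y [yM /mirror_poly_eq0 y0 _]] := mirror_point_small_deviation j p ltr01.
have [x [_ /mirror_poly_eq0 mx hx]] := meval_min (deviation j p) yM y0.
exists x => //; apply: deviation_eq0; apply/eqP; rewrite eq_le deviation_ge0.
rewrite andbT; apply/ler_addgt0Pl => e /(mirror_point_small_deviation j p).
case=> z [zM /mirror_poly_eq0 z0 ze]; rewrite addr0.
exact: le_trans (hx _ zM z0) ze.
Qed.

Lemma on_mirror_flat_points x : on_mirror x -> flat_points rG n.-1 x.
Proof.
case=> s [sG rs xs]; exists (eigenspace (rG s) 1); split.
- exists [set s]%SET; split=> [t /set1P -> //|].
  by rewrite big_set1; exact/eqmxP.
- have [a a1 hs] := reflection_unit_normal rs.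
  have a0 : a != 0 by rewrite -dot_eq0 a1 oner_eq0.
  rewrite /eigenspace mxrank_ker -subn1; congr (_ - _)%N.
  (* Every row of [rG s - 1%:M] is a multiple of [a], and the matrix sends [a] to -2a, so its rank
     is exactly 1. *)
  have hB v : v *m (rG s - 1%:M) = (- (2 * dot v a)) *: a.
    by rewrite mulmxBr mulmx1 hs addrAC subrr add0r scaleNr.
  apply/eqP; rewrite eqn_leq; apply/andP; split.
    apply: leq_trans (rank_leq_row a); apply/mxrankS/row_subP => i.
    by rewrite rowE hB scalemx_sub.
  rewrite lt0n mxrank_eq0; apply: contraNneq a0 => s0.
  have := hB a; rewrite s0 mulmx0 a1 mulr1 => /esym/eqP.
  by rewrite scaler_eq0 oppr_eq0 pnatr_eq0.
- by apply/eigenspaceP; rewrite xs scale1r.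
Qed.

Lemma real_zeros_fiber m (f : 'I_m -> {mpoly R[n]}) (j : 'I_n) p x :
  (forall k, in_subalgebra_omit pi j (f k)) ->
  (forall i, i != j -> (tnth pi i).@[x ord0] = (tnth pi i).@[p ord0]) ->
  real_zeros f p -> real_zeros f x.
Proof.
move=> hf hx hp k; have [P e] := hf k; rewrite -(hp k) e !comp_mpoly_meval.
by apply: meval_eq => i; rewrite tnth_mktuple hx // eq_sym neq_lift.
Qed.

End Main.

Local Open Scope classical_set_scope.

Theorem theorem3 (R : realType) (n : nat) (gT : finGroupType) (G : {group gT})
    (rG : mx_representation R G n)
    (hG : reflection_group rG) (hess : essential rG)
    (pi : n.-tuple (mpoly.mpoly n R)) (hpi : basic_invariants rG pi)
    (m : nat) (f : 'I_m -> mpoly.mpoly n R)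
    (hX : real_zeros f !=set0)
    (hf : exists j : 'I_n, forall k : 'I_m, in_subalgebra_omit pi j (f k)) :
  (real_zeros f `&` flat_points rG n.-1) !=set0.
Proof.
case: hX hf => p hp [j hj].
have [x mx hx] := mirror_point_on_fiber hG hess hpi j p.
exists x; split; first exact: real_zeros_fiber hj hx hp.
exact: on_mirror_flat_points.
Qed.
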